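(* Let $E$ be a set with word conditions, let $G:=G(E)$, and let $A$ be an $E$-twisted ring, also regarded as a $G$-ring. Then the category of $E$-twisted $A$-modules is equivalent (and even isomorphic) to the category of $G$-$A$-modules.
   Context: $W(E)$ is the free monoid of words (finite sequences, including the empty word $1$) on $E$. A set of word conditions on $E$ is a subset $\Gamma\subset W(E)\times W(E)$; a pair $(u,v)\in\Gamma$ is written ''$u=v$'' and called an $E$-condition. $G(E)$ is the quotient monoid of $W(E)$ by the monoid congruence generated by $\Gamma$. An $E$-twisted ring is a (unital, not necessarily commutative) ring $A$ with ring endomorphisms $\sigma_{A,i}$ ($i\in E$) such that, writing $\sigma_{A,u}=\sigma_{A,i_0}\circ\cdots\circ\sigma_{A,i_{n-1}}$ for $u=i_0\cdots i_{n-1}$ and $\sigma_{A,1}=\mathrm{Id}_A$, one has $\sigma_{A,u}=\sigma_{A,v}$ for every $E$-condition $u=v$. Equivalently, $A$ is a $G(E)$-ring: a ring with an action of $G(E)$ by ring endomorphisms, the class of $i$ acting by $\sigma_{A,i}$. For a ring endomorphism $\sigma$ of $A$ and a left $A$-module $M$, $\sigma^*M:=A\,{}_{\sigma}\!\otimes_A M$ is extension of scalars along $\sigma$. An $E$-twisted $A$-module is a left $A$-module $M$ with $A$-linear maps $\sigma_{M,i}:\sigma_{A,i}^*M\to M$ ($i\in E$) such that $$\sigma_{M,i_0}\circ\sigma_{A,i_0}^*(\sigma_{M,i_1})\circ\cdots\circ\sigma_{A,i_0\cdots i_{n-1}}^*(\sigma_{M,i_n})=\sigma_{M,j_0}\circ\sigma_{A,j_0}^*(\sigma_{M,j_1})\circ\cdots\circ\sigma_{A,j_0\cdots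 j_{m-1}}^*(\sigma_{M,j_m})$$ for every $E$-condition $i_0\cdots i_n=j_0\cdots j_m$ (the composite attached to the empty word being the identity). A morphism $(M,\underline\sigma_M)\to(N,\underline\sigma_N)$ is an $A$-linear map $u$ with $\sigma_{N,i}\circ\sigma_{A,i}^*(u)=u\circ\sigma_{M,i}$ for all $i\in E$. For a $G$-ring $A$, a $G$-$A$-module is a left $A$-module $M$ with an action of the monoid $G$ by additive maps satisfying $g.(xs)=(g.x)(g.s)$ for $g\in G,x\in A,s\in M$; a morphism is an $A$-linear map compatible with the actions of $G$. *)

(* Defs.v *)
From HB Require Import structures.
From mathcomp Require Import all_boot all_algebra.
From mathcomp Require Import generic_quotient ring_quotient.
From mathcomp Require Import boolp classical_sets freeg.

Set Implicit Arguments.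
Unset Strict Implicit.
Unset Printing Implicit Defensive.

Import GRing.Theory.
Local Open Scope ring_scope.
Local Open Scope quotient_scope.


Record category := Category {
  obj :> Type;
  hom : obj -> obj -> Type;
  idm : forall x, hom x x;
  compm : forall x y z, hom y z -> hom x y -> hom x z;
  compm1 : forall x y (f : hom x y), compm f (idm x) = f;
  comp1m : forall x y (f : hom x y), compm (idm y) f = f;
  compmA : forall x y z t (h : hom z t) (g : hom y z) (f : hom x y),
    compm h (compm g f) = compm (compm h g) f
}.
Arguments idm {c} x.

Record functor (C D : category) := Functor {
  fobj :> C -> D;
  fmap : forall x y, hom x y -> hom (fobj x) (fobj y);
  fmap1 : forall x, fmap (idm x) = idm (fobj x);
  fmapM : forall x y z (g : hom y z) (f : hom x y),
    fmap (compm g f) = compm (fmap g) (fmap f)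
}.
Arguments fmap {C D} _ {x y} _.

Definition functor_id (C : category) : functor C C :=
  @Functor C C id (fun x y f => f) (fun x => erefl) (fun x y z g f => erefl).

Section FunctorComp.
Variables (C D E : category) (G : functor D E) (F : functor C D).

Definition comp_fmap x y (f : hom x y) : hom (G (F x)) (G (F y)) :=
  fmap G (fmap F f).

Lemma comp_fmap1 x : comp_fmap (idm x) = idm (G (F x)).
Proof. by rewrite /comp_fmap !fmap1. Qed.

Lemma comp_fmapM x y z (g : hom y z) (f : hom x y) :
  comp_fmap (compm g f) = compm (comp_fmap g) (comp_fmap f).
Proof. by rewrite /comp_fmap !fmapM. Qed.

Definition functor_comp : functor C E := Functor comp_fmap1 comp_fmapM.
End FunctorComp.

Definition is_iso (C : category) (x y : C) (f : hom x y) :=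
  exists g : hom y x, compm g f = idm x /\ compm f g = idm y.

Definition nat_iso (C D : category) (F G : functor C D) :=
  exists eta : forall x, hom (F x) (G x),
    (forall x, is_iso (eta x)) /\
    (forall x y (f : hom x y),
       compm (eta y) (fmap F f) = compm (fmap G f) (eta x)).

Definition cat_equivalent (C D : category) :=
  exists (F : functor C D) (G : functor D C),
    nat_iso (functor_comp G F) (functor_id C) /\
    nat_iso (functor_comp F G) (functor_id D).

Definition cat_isomorphic (C D : category) :=
  exists (F : functor C D) (G : functor D C),
    functor_comp G F = functor_id C /\ functor_comp F G = functor_id D.


Section Presentation.
Variable E : Type.

(* A copy of seq E with a classical choice structure, E being any type. *)
Definition word := seq E.
HB.instance Definition _ := gen_eqMixin word.
HB.instance Definition _ := gen_choiceMixin word.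

Variable Gam : set (seq E * seq E).

Inductive word_cong : seq E -> seq E -> Prop :=
| WordCongCond u v : Gam (u, v) -> word_cong u v
| WordCongRefl u : word_cong u u
| WordCongSym u v : word_cong u v -> word_cong v u
| WordCongTrans u v w : word_cong u v -> word_cong v w -> word_cong u w
| WordCongCat u v u' v' :
    word_cong u v -> word_cong u' v' -> word_cong (u ++ u') (v ++ v').

Definition word_congb (u v : word) : bool := `[< word_cong u v >].

Lemma word_congb_refl : reflexive word_congb.
Proof. by move=> u; apply/asboolP; exact: WordCongRefl. Qed.

Lemma word_congb_sym : symmetric word_congb.
Proof.
by move=> u v; apply/asboolP/asboolP => /asboolP h; apply: WordCongSym;
  apply/asboolP.
Qed.

Lemma word_congb_trans : transitive word_congb.
Proof.
move=> v u w /asboolP uv /asboolP vw; apply/asboolP.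
exact: WordCongTrans uv vw.
Qed.

Canonical word_congb_equiv :=
  EquivRel word_congb word_congb_refl word_congb_sym word_congb_trans.

Definition presented := {eq_quot word_congb}.
HB.instance Definition _ : EqQuotient word word_congb presented :=
  EqQuotient.on presented.
HB.instance Definition _ := Choice.on presented.

Definition word_class (u : seq E) : presented := \pi_presented (u : word).

Lemma word_classP (u v : seq E) :
  word_class u = word_class v <-> word_cong u v.
Proof.
rewrite /word_class; split=> [/eqmodP /asboolP //|h].
by apply/eqmodP/asboolP.
Qed.

Lemma word_cong_repr (u : seq E) : word_cong (repr (word_class u)) u.
Proof. by apply/word_classP; rewrite /word_class reprK. Qed.

Definition pres_one : presented := word_class [::].
Definition pres_mul (g h : presented) : presented :=
  word_class (repr g ++ repr h).

Lemma pres_mulE (u v : seq E) :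
  pres_mul (word_class u) (word_class v) = word_class (u ++ v).
Proof. by apply/word_classP; apply: WordCongCat; exact: word_cong_repr. Qed.

Lemma word_class_repr (g : presented) : g = word_class (repr g).
Proof. by rewrite /word_class reprK. Qed.

Lemma pres_mulA : associative pres_mul.
Proof.
move=> x y z.
rewrite [x]word_class_repr [y]word_class_repr [z]word_class_repr.
by rewrite !pres_mulE catA.
Qed.

Lemma pres_mul1 : left_id pres_one pres_mul.
Proof. by move=> x; rewrite [x]word_class_repr pres_mulE. Qed.

Lemma pres_1mul : right_id pres_one pres_mul.
Proof. by move=> x; rewrite [x]word_class_repr pres_mulE cats0. Qed.

HB.instance Definition _ :=
  isMonoid.Build presented pres_mulA pres_mul1 pres_1mul.

End Presentation.

(* sigma^* M = A (x)_A M, where the left factor A is a right A-module through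
   sigma: the quotient of the free abelian group on A * M by the usual
   relations, with A acting by left multiplication on the left factor.
   sigma is a bare function (only ever a ring endomorphism below), so that
   for instance ((f \o g) \o h)^* M and (f \o (g \o h))^* M are convertible. *)
Section ExtScalars.
Variables (A : pzRingType) (sigma : A -> A) (M : lmodType A).

Notation free := {freeg (A * M)%type / int}.

Inductive tens_ker : free -> Prop :=
| TensDl b c m :
    tens_ker (<< (b + c, m) >> - (<< (b, m) >> + << (c, m) >>))
| TensDr b m n :
    tens_ker (<< (b, m + n) >> - (<< (b, m) >> + << (b, n) >>))
| TensBal b x m :
    tens_ker (<< (b * sigma x, m) >> - << (b, x *: m) >>)
| TensKer0 : tens_ker 0
| TensKerB D D' : tens_ker D -> tens_ker D' -> tens_ker (D - D').

Definition tens_kerb : pred free := fun D => `[< tens_ker D >].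

Lemma tens_kerb_closed : zmod_closed tens_kerb.
Proof.
split; first by apply/asboolP; exact: TensKer0.
by move=> D D' /asboolP h /asboolP h'; apply/asboolP; exact: TensKerB.
Qed.
HB.instance Definition _ := GRing.isZmodClosed.Build free tens_kerb
  tens_kerb_closed.

Definition tens_sub := GRing.ZmodClosed.clone free tens_kerb _.

Definition ext_scal := Quotient.quot tens_sub.
HB.instance Definition _ := GRing.Zmodule.on ext_scal.

Definition tens_pi (D : free) : ext_scal := \pi_(Quotient.quot tens_sub) D.

Lemma tens_pi_additive : zmod_morphism tens_pi.
Proof. by move=> D D'; rewrite /tens_pi !piE. Qed.
HB.instance Definition _ := GRing.isZmodMorphism.Build free ext_scal tens_pi
  tens_pi_additive.

Lemma tens_pi_eq0 D : tens_ker D -> tens_pi D = 0.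
Proof.
move=> kD; rewrite -(raddf0 tens_pi); apply/eqP.
rewrite /tens_pi -Quotient.idealrBE subr0.
exact/asboolP.
Qed.

Lemma tens_pi_repr (x : ext_scal) : tens_pi (repr x) = x.
Proof. exact: reprK. Qed.

Lemma tens_ker_repr D : tens_ker (repr (tens_pi D) - D).
Proof.
have : \pi_(Quotient.quot tens_sub) (repr (tens_pi D)) ==
  \pi_(Quotient.quot tens_sub) D by rewrite reprK.
by rewrite -Quotient.idealrBE => /asboolP.
Qed.

Definition tens (b : A) (m : M) : ext_scal := tens_pi << (b, m) >>.

Lemma tensDl b c m : tens (b + c) m = tens b m + tens c m.
Proof.
apply/subr0_eq; rewrite /tens -(raddfD tens_pi) -(raddfB tens_pi).
exact/tens_pi_eq0/TensDl.
Qed.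

Lemma tensDr b m n : tens b (m + n) = tens b m + tens b n.
Proof.
apply/subr0_eq; rewrite /tens -(raddfD tens_pi) -(raddfB tens_pi).
exact/tens_pi_eq0/TensDr.
Qed.

Lemma tens_bal b x m : tens (b * sigma x) m = tens b (x *: m).
Proof.
apply/subr0_eq; rewrite /tens -(raddfB tens_pi).
exact/tens_pi_eq0/TensBal.
Qed.

Lemma tens_ind (P : ext_scal -> Prop) :
  P 0 -> (forall x y, P x -> P y -> P (x - y)) -> (forall b m, P (tens b m)) ->
  forall x, P x.
Proof.
move=> P0 PB Pt x; rewrite -[x]tens_pi_repr.
have PN y : P y -> P (- y) by move=> Py; rewrite -sub0r; exact: PB.
have PD y z : P y -> P z -> P (y + z).
  by move=> Py Pz; rewrite -[z]opprK; apply: PB => //; exact: PN.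
have PMn y n : P y -> P (y *+ n).
  by move=> Py; elim: n => [|n IHn]; rewrite ?mulr0n // mulrS; exact: PD.
have PMz y (k : int) : P y -> P (y *~ k).
  case: k => n Py; first exact: PMn.
  by rewrite NegzE mulrNz; apply: PN; exact: PMn.
rewrite -(freeg_sumE (repr x)) raddf_sum.
apply: (big_ind P) => // -[b m] _.
rewrite -[coeff _ _]intz -freegU_mulz raddfMz.
exact/PMz/Pt.
Qed.

Section Lift.
Variables (N : zmodType) (phi : A -> M -> N).

Definition balanced :=
  [/\ forall b c m, phi (b + c) m = phi b m + phi c m,
      forall b m n, phi b (m + n) = phi b m + phi b n
    & forall b x m, phi (b * sigma x) m = phi b (x *: m)].

Definition free_lift (D : free) : N :=
  fglift (fun p : A * M => phi p.1 p.2 : zmodule N) D.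
Definition tens_lift (x : ext_scal) : N := free_lift (repr x).

Lemma free_liftB : zmod_morphism free_lift.
Proof.
exact: (@lift_is_additive _ _ _ (fun p : A * M => phi p.1 p.2 : zmodule N)).
Qed.
HB.instance Definition _ := GRing.isZmodMorphism.Build free N free_lift
  free_liftB.

Lemma free_liftU b m : free_lift << (b, m) >> = phi b m.
Proof. by rewrite /free_lift liftU scale1r. Qed.

Hypothesis phi_bal : balanced.

Lemma free_lift_ker D : tens_ker D -> free_lift D = 0.
Proof.
have [phiDl phiDr phiZ] := phi_bal.
elim=> [b c m|b m n|b x m||D1 D2 _ h1 _ h2].
- by rewrite raddfB raddfD /= !free_liftU phiDl subrr.
- by rewrite raddfB raddfD /= !free_liftU phiDr subrr.
- by rewrite raddfB /= !free_liftU phiZ subrr.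
- exact: raddf0.
- by rewrite raddfB /= h1 h2 subrr.
Qed.

Lemma tens_lift_pi D : tens_lift (tens_pi D) = free_lift D.
Proof.
by apply/subr0_eq; rewrite /tens_lift -(raddfB free_lift);
  exact/free_lift_ker/tens_ker_repr.
Qed.

Lemma tens_liftB : zmod_morphism tens_lift.
Proof.
move=> x y; rewrite -[x]tens_pi_repr -[y]tens_pi_repr.
by rewrite -(raddfB tens_pi) /= !tens_lift_pi raddfB.
Qed.

Lemma tens_lift_tens b m : tens_lift (tens b m) = phi b m.
Proof. by rewrite tens_lift_pi free_liftU. Qed.

End Lift.

Lemma ext_scale_balanced (a : A) : balanced (fun b m => tens (a * b) m).
Proof.
split=> [b c m|b m n|b x m].
- by rewrite mulrDr tensDl.
- exact: tensDr.
- by rewrite mulrA tens_bal.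
Qed.

Definition ext_scale (a : A) (x : ext_scal) : ext_scal :=
  tens_lift (fun b m => tens (a * b) m) x.

Lemma ext_scaleB a : zmod_morphism (ext_scale a).
Proof. exact/tens_liftB/ext_scale_balanced. Qed.

Lemma ext_scale_tens a b m : ext_scale a (tens b m) = tens (a * b) m.
Proof. exact/tens_lift_tens/ext_scale_balanced. Qed.

HB.instance Definition _ a :=
  GRing.isZmodMorphism.Build ext_scal ext_scal (ext_scale a) (ext_scaleB a).

Lemma ext_scaleA a b x : ext_scale a (ext_scale b x) = ext_scale (a * b) x.
Proof.
elim/tens_ind: x => [|x y hx hy|c m]; first by rewrite !raddf0.
- by rewrite !raddfB /= hx hy.
- by rewrite !ext_scale_tens mulrA.
Qed.

Lemma ext_scale1 : left_id 1 ext_scale.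
Proof.
move=> x; elim/tens_ind: x => [|x y hx hy|c m]; first by rewrite raddf0.
- by rewrite raddfB /= hx hy.
- by rewrite ext_scale_tens mul1r.
Qed.

Lemma ext_scaleDr : right_distributive ext_scale +%R.
Proof. by move=> a x y; rewrite raddfD. Qed.

Lemma ext_scaleDl x : {morph ext_scale^~ x : a b / a + b}.
Proof.
move=> a b; elim/tens_ind: x => [|x y hx hy|c m].
- by rewrite !raddf0 addr0.
- by rewrite !raddfB /= hx hy opprD addrACA.
- by rewrite !ext_scale_tens mulrDl tensDl.
Qed.

HB.instance Definition _ := GRing.Zmodule_isLmodule.Build A ext_scal
  ext_scaleA ext_scale1 ext_scaleDr ext_scaleDl.

Lemma tensZ a b m : a *: tens b m = tens (a * b) m.
Proof. exact: ext_scale_tens. Qed.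

End ExtScalars.

(* A sigma-semilinear phi : M -> N induces the A-linear map
   sigma^* M -> N, b (x) m |-> b *: phi m. *)
Section ExtLift.
Variables (A : pzRingType) (sigma : {rmorphism A -> A}) (M N : lmodType A).
Variable phi : M -> N.
Hypothesis phi_semilinear : linear_for (sigma \; *:%R) phi.

Lemma ext_lift_balanced : balanced sigma (fun b m => b *: phi m).
Proof.
have phiD m n : phi (m + n) = phi m + phi n.
  by rewrite -[m in LHS]scale1r phi_semilinear /= rmorph1 scale1r.
have phi0 : phi 0 = 0.
  by apply: (@addIr _ (phi 0)); rewrite -phiD !add0r.
split=> [b c m|b m n|b x m]; first exact: scalerDl.
- by rewrite phiD scalerDr.
- by rewrite -[x *: m]addr0 phi_semilinear phi0 addr0 /= scalerA.
Qed.

Definition ext_lift_fun (_ : linear_for (sigma \; *:%R) phi)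
    (x : ext_scal sigma M) : N :=
  tens_lift (fun b m => b *: phi m) x.

Local Notation lift := (ext_lift_fun phi_semilinear).

Lemma ext_lift_is_linear : linear lift.
Proof.
have liftB : zmod_morphism lift by exact: tens_liftB ext_lift_balanced.
have lift0 : lift 0 = 0 by rewrite -[0 in LHS](subrr 0) liftB subrr.
move=> a x y.
have liftD z t : lift (z + t) = lift z + lift t.
  by rewrite -[t in LHS]opprK liftB -[- t]sub0r liftB lift0 sub0r opprK.
rewrite liftD; congr (_ + _).
elim/tens_ind: x => [|z t hz ht|b m]; first by rewrite scaler0 lift0 scaler0.
- by rewrite scalerBr !liftB hz ht scalerBr.
- by rewrite tensZ /ext_lift_fun !(tens_lift_tens ext_lift_balanced) scalerA.
Qed.

HB.instance Definition _ :=
  GRing.isLinear.Build A (ext_scal sigma M) N *:%R lift ext_lift_is_linear.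

Definition ext_lift : {linear ext_scal sigma M -> N} := lift.

Lemma ext_lift_tens b m : ext_lift (tens sigma b m) = b *: phi m.
Proof. exact: (tens_lift_tens ext_lift_balanced). Qed.

End ExtLift.

Section ExtMaps.
Variable A : pzRingType.
Implicit Types (sigma tau : {rmorphism A -> A}) (M N P : lmodType A).

Lemma tens1_linear sigma M N (u : {linear M -> N}) :
  linear_for (sigma \; *:%R) (fun m => tens sigma 1 (u m)).
Proof.
by move=> a m n; rewrite linearP tensDr -tens_bal mul1r /= tensZ mulr1.
Qed.

Definition ext_map sigma M N (u : {linear M -> N}) :
    {linear ext_scal sigma M -> ext_scal sigma N} :=
  ext_lift (tens1_linear sigma u).

Lemma ext_map_tens sigma M N (u : {linear M -> N}) b m :
  ext_map sigma u (tens sigma b m) = tens sigma b (u m).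
Proof. by rewrite ext_lift_tens tensZ mulr1. Qed.

Lemma ext_map_id sigma M : ext_map sigma (idfun : {linear M -> M}) =1 id.
Proof.
move=> x; elim/tens_ind: x => [|x y hx hy|b m]; first by rewrite raddf0.
- by rewrite raddfB /= hx hy.
- by rewrite ext_map_tens.
Qed.

Lemma ext_map_comp sigma M N P (v : {linear N -> P}) (u : {linear M -> N}) :
  ext_map sigma (v \o u : {linear M -> P}) =1 ext_map sigma v \o ext_map sigma u.
Proof.
move=> x; rewrite [RHS]/comp.
elim/tens_ind: x => [|x y hx hy|b m]; first by rewrite !linear0.
- by rewrite !linearB hx hy.
- by rewrite !ext_map_tens.
Qed.

Lemma ext_unit_linear M : linear_for ((idfun : A -> A) \; *:%R) (@idfun M).
Proof. by []. Qed.

(* The canonical isomorphism id^* M -> M, b (x) m |-> b *: m. *)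
Definition ext_unit M : {linear ext_scal (idfun : A -> A) M -> M} :=
  ext_lift (ext_unit_linear (M := M)).

Lemma ext_unit_tens M b (m : M) : ext_unit M (tens idfun b m) = b *: m.
Proof. exact: ext_lift_tens. Qed.

Lemma ext_assoc_linear sigma tau M :
  linear_for ((sigma \o tau) \; *:%R)
    (fun m : M => tens sigma 1 (tens tau 1 m)).
Proof.
move=> a m n; rewrite tensDr -tens_bal mul1r tensDr.
by rewrite -[tau a]mulr1 -tensZ -tens_bal mul1r /= tensZ mulr1.
Qed.

(* The canonical isomorphism (sigma o tau)^* M -> sigma^*(tau^* M),
   b (x) m |-> b (x) (1 (x) m). *)
Definition ext_assoc sigma tau M :
    {linear ext_scal (sigma \o tau) M -> ext_scal sigma (ext_scal tau M)} :=
  ext_lift (ext_assoc_linear sigma tau (M := M)).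

Lemma ext_assoc_tens sigma tau M b (m : M) :
  ext_assoc sigma tau M (tens (sigma \o tau) b m)
  = tens sigma b (tens tau 1 m).
Proof. by rewrite ext_lift_tens tensZ mulr1. Qed.

Lemma ext_cast_linear sigma tau (e : sigma =1 tau) M :
  linear_for (sigma \; *:%R) (fun m : M => tens tau 1 m).
Proof.
by move=> a m n; rewrite tensDr -tens_bal mul1r /= tensZ mulr1 e.
Qed.

(* The identity of sigma^* M, when sigma and tau are the same endomorphism. *)
Definition ext_cast sigma tau (e : sigma =1 tau) M :
    {linear ext_scal sigma M -> ext_scal tau M} :=
  ext_lift (ext_cast_linear e (M := M)).

Lemma ext_cast_tens sigma tau (e : sigma =1 tau) M b (m : M) :
  ext_cast e M (tens sigma b m) = tens tau b m.
Proof. by rewrite ext_lift_tens tensZ mulr1. Qed.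

End ExtMaps.

Section Twisted.
Variables (E : Type) (Gam : set (seq E * seq E)).

Section WordEndo.
Variables (A : pzRingType) (sigma : E -> {rmorphism A -> A}).

Fixpoint word_endo (u : seq E) : {rmorphism A -> A} :=
  if u is i :: v then (sigma i \o word_endo v : {rmorphism A -> A})
  else (idfun : {rmorphism A -> A}).

Lemma word_endo_cat u v : word_endo (u ++ v) =1 word_endo u \o word_endo v.
Proof. by move=> x; elim: u => //= i u ->. Qed.

Variables (M : lmodType A).
Variable sigmaM : forall i, {linear ext_scal (sigma i) M -> M}.

(* Given tau = sigma_p and the composite h : sigma_p^* M -> M attached to p,
   the composite attached to p ++ u: each letter i read after p contributes
   sigma_p^*(sigma_{M,i}) on the right. *)
Fixpoint word_comp_from (tau : {rmorphism A -> A})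
    (h : {linear ext_scal tau M -> M}) (u : seq E) :
    {linear ext_scal (tau \o word_endo u) M -> M} :=
  if u is i :: v then
    word_comp_from (tau := tau \o sigma i)
      (h \o (ext_map tau (sigmaM i) \o ext_assoc tau (sigma i) M)) v
  else h.

Definition word_comp (u : seq E) : {linear ext_scal (word_endo u) M -> M} :=
  if u is i :: v then word_comp_from (sigmaM i) v else ext_unit M.

End WordEndo.

Record twisted_ring := TwistedRing {
  tw_ring :> pzRingType;
  tw_sigma : E -> {rmorphism tw_ring -> tw_ring};
  tw_cond : forall u v, Gam (u, v) ->
    word_endo tw_sigma u =1 word_endo tw_sigma v
}.

(* The two composites attached to a condition u = v have sources sigma_u^* M
   and sigma_v^* M, which are identified through ext_cast. *)
Record twisted_module (A : twisted_ring) := TwistedModule {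
  twm_mod :> lmodType A;
  twm_sigma : forall i, {linear ext_scal (tw_sigma A i) twm_mod -> twm_mod};
  twm_cond : forall u v (uv : Gam (u, v)),
    word_comp twm_sigma u =1 word_comp twm_sigma v \o ext_cast (tw_cond uv) twm_mod
}.

Record twisted_hom (A : twisted_ring) (M N : twisted_module A) := TwistedHom {
  twh_fun :> {linear M -> N};
  twh_comm : forall i,
    twm_sigma N i \o ext_map (tw_sigma A i) twh_fun =1 twh_fun \o twm_sigma M i
}.

End Twisted.


Record monoid_ring (G : monoidType) := MonoidRing {
  mr_ring :> pzRingType;
  mr_act : G -> {rmorphism mr_ring -> mr_ring};
  mr_act1 : mr_act 1%g =1 id;
  mr_actM : forall g h, mr_act (g * h)%g =1 mr_act g \o mr_act h
}.

Record monoid_module (G : monoidType) (A : monoid_ring G) := MonoidModule {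
  mm_mod :> lmodType A;
  mm_act : G -> {additive mm_mod -> mm_mod};
  mm_act1 : mm_act 1%g =1 id;
  mm_actM : forall g h, mm_act (g * h)%g =1 mm_act g \o mm_act h;
  mm_actZ : forall g (x : A) (s : mm_mod),
    mm_act g (x *: s) = mr_act A g x *: mm_act g s
}.

Record monoid_hom (G : monoidType) (A : monoid_ring G)
    (M N : monoid_module A) := MonoidHom {
  mh_fun :> {linear M -> N};
  mh_comm : forall g, mm_act N g \o mh_fun =1 mh_fun \o mm_act M g
}.


Section TwistedRingAction.
Variables (E : Type) (Gam : set (seq E * seq E)) (A : twisted_ring Gam).

Lemma word_endo_cong u v : word_cong Gam u v ->
  word_endo (tw_sigma A) u =1 word_endo (tw_sigma A) v.
Proof.
elim=> [{}u {}v uv|{}u|{}u {}v _ h|{}u {}v w _ h1 _ h2|{}u {}v u' v' _ h1 _ h2] x.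
- exact: tw_cond.
- by [].
- by rewrite h.
- by rewrite h1 h2.
- by rewrite !word_endo_cat /= h2 h1.
Qed.

Definition tw_act (g : presented Gam) : {rmorphism A -> A} :=
  word_endo (tw_sigma A) (repr g).

Lemma tw_act_class u : tw_act (word_class Gam u) =1 word_endo (tw_sigma A) u.
Proof. exact/word_endo_cong/word_cong_repr. Qed.

Lemma tw_act_letter i : tw_act (word_class Gam [:: i]) =1 tw_sigma A i.
Proof. exact: tw_act_class. Qed.

Lemma tw_act1 : tw_act 1%g =1 id.
Proof. exact: (tw_act_class [::]). Qed.

Lemma tw_actM g h : tw_act (g * h)%g =1 tw_act g \o tw_act h.
Proof.
move=> x; rewrite (_ : (g * h)%g = word_class Gam (repr g ++ repr h)) //.
by rewrite tw_act_class word_endo_cat.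
Qed.

Definition twisted_monoid_ring : monoid_ring (presented Gam) :=
  MonoidRing tw_act1 tw_actM.
End TwistedRingAction.


Lemma linear_eq (A : pzRingType) (M N : lmodType A) (f g : {linear M -> N}) :
  f =1 g -> f = g.
Proof.
case: f g => [f cf] [g cg] /= /funext fg; case: g / fg cg => cg.
congr GRing.Linear.Pack.
case: cf cg => [[[f0 fD]] [fZ]] [[[g0 gD]] [gZ]].
by rewrite (Prop_irrelevance f0 g0) (Prop_irrelevance fD gD) (Prop_irrelevance fZ gZ).
Qed.

Section TwistedCategory.
Variables (E : Type) (Gam : set (seq E * seq E)) (A : twisted_ring Gam).
Implicit Types M N P Q : twisted_module A.

Lemma twisted_hom_eq M N (f g : twisted_hom M N) : f =1 g -> f = g.
Proof.
case: f g => [f cf] [g cg] /= /linear_eq fg; case: g / fg cg => cg.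
by rewrite (Prop_irrelevance cf cg).
Qed.

Lemma twisted_id_comm M i :
  twm_sigma M i \o ext_map (tw_sigma A i) (idfun : {linear M -> M})
  =1 idfun \o twm_sigma M i.
Proof. by move=> x /=; rewrite ext_map_id. Qed.

Definition twisted_id M : twisted_hom M M := TwistedHom (twisted_id_comm (M := M)).

Lemma twisted_comp_comm M N P (g : twisted_hom N P) (f : twisted_hom M N) i :
  twm_sigma P i \o ext_map (tw_sigma A i) (g \o f : {linear M -> P})
  =1 (g \o f) \o twm_sigma M i.
Proof.
move=> x; rewrite [LHS]/comp ext_map_comp /=.
by have /= -> := twh_comm g (ext_map _ f x); have /= -> := twh_comm f x.
Qed.

Definition twisted_comp M N P (g : twisted_hom N P) (f : twisted_hom M N) :
  twisted_hom M P := TwistedHom (twisted_comp_comm g f).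

Definition twisted_modules : category.
Proof.
refine (@Category (twisted_module A) (@twisted_hom E Gam A) twisted_id
  twisted_comp _ _ _) => *; exact: twisted_hom_eq.
Defined.
End TwistedCategory.

Section MonoidCategory.
Variables (G : monoidType) (A : monoid_ring G).
Implicit Types M N P Q : monoid_module A.

Lemma monoid_hom_eq M N (f g : monoid_hom M N) : f =1 g -> f = g.
Proof.
case: f g => [f cf] [g cg] /= /linear_eq fg; case: g / fg cg => cg.
by rewrite (Prop_irrelevance cf cg).
Qed.

Definition monoid_id M : monoid_hom M M :=
  @MonoidHom G A M M (idfun : {linear M -> M}) (fun g s => erefl).

Lemma monoid_comp_comm M N P (g : monoid_hom N P) (f : monoid_hom M N) k :
  mm_act P k \o (g \o f : {linear M -> P}) =1 (g \o f) \o mm_act M k.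
Proof. by move=> s /=; have /= -> := mh_comm g k (f s); have /= -> := mh_comm f k s. Qed.

Definition monoid_comp M N P (g : monoid_hom N P) (f : monoid_hom M N) :
  monoid_hom M P := MonoidHom (monoid_comp_comm g f).

Definition monoid_modules : category.
Proof.
refine (@Category (monoid_module A) (@monoid_hom G A) monoid_id
  monoid_comp _ _ _) => *; exact: monoid_hom_eq.
Defined.
End MonoidCategory.

(* Main.v *)
Require Import Defs.
From HB Require Import structures.
From mathcomp Require Import all_boot all_algebra.
From mathcomp Require Import boolp classical_sets.

(** An A-linear map [s : sigma^* M -> M] is the same thing as a
    [sigma]-semilinear map [M -> M]: send [s] to [m |-> s (1 (x) m)], and back
    by the universal property of the extension of scalars.  So a family
    [(sigma_{M,i})_i] is a family of semilinear maps indexed by the letters,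
    hence an action of the free monoid of words on [M].

    The composite attached to a word [u] maps [b (x) m] to [b *: (u . m)]
    ([word_comp_tens]); therefore the composites attached to [u] and [v] agree
    exactly when [u] and [v] act in the same way, and the twisted-module
    conditions say that the action of words factors through the presented
    monoid ([word_act_cong]).  In one direction a class acts through any of its
    words; in the other, a letter acts through its class.  Morphisms are the
    same linear maps on both sides, because generators detect equivariance.

    Neither construction changes the underlying module or the underlying linear
    map, so both round trips are identities on the nose.  Equality of functors
    asks for more than equality on objects: [functor_eq_id] reduces the equality
    of an endofunctor with the identity to a naturality square for the morphisms
    [eq_hom] that are induced by the equalities of objects, and these have
    identity underlying map ([twisted_eq_hom], [monoid_eq_hom]). *)

Set Implicit Arguments.
Unset Strict Implicit.
Unset Printing Implicit Defensive.

Import GRing.Theory.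
Local Open Scope ring_scope.

(** * Equalities of functors *)

Definition eq_hom (C : category) (x y : C) (e : x = y) : Defs.hom x y :=
  ecast z (Defs.hom x z) e (idm x).

(** Stating the compatibility on morphisms as a naturality square avoids
    transporting [fmap F f] along equalities of its source and target. *)
Lemma functor_eq_id (C : category) (F : functor C C)
    (e : forall x, F x = x) :
  (forall x y (f : Defs.hom x y),
     compm (eq_hom (e y)) (fmap F f) = compm f (eq_hom (e x))) ->
  F = functor_id C.
Proof.
case: F e => Fo Fm F1 FM /= e.
have Fo_id : Fo = id by apply: funext.
subst Fo => nat_e.
have Fm_id : Fm = fun x y f => f.
  apply: functional_extensionality_dep => x.
  apply: functional_extensionality_dep => y.
  apply: functional_extensionality_dep => f.
  have := nat_e x y f.
  by rewrite (Prop_irrelevance (e x) erefl) (Prop_irrelevance (e y) erefl)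
    /= comp1m compm1.
subst Fm.
by rewrite /functor_id; congr Functor; exact: Prop_irrelevance.
Qed.

Lemma nat_iso_refl (C D : category) (F : functor C D) : nat_iso F F.
Proof.
exists (fun x => idm (F x)); split=> [x|x y f]; last by rewrite comp1m compm1.
by exists (idm (F x)); rewrite comp1m.
Qed.

Lemma cat_isomorphic_equivalent (C D : category) :
  cat_isomorphic C D -> cat_equivalent C D.
Proof.
move=> [F [G [GF FG]]]; exists F, G; rewrite GF FG.
by split; exact: nat_iso_refl.
Qed.

Lemma additive_eq (U V : nmodType) (f g : {additive U -> V}) : f =1 g -> f = g.
Proof.
case: f g => [f cf] [g cg] /= /funext fg; case: g / fg cg => cg.
by congr GRing.Additive.Pack; case: cf cg => [[f0]] [[g0]];
  rewrite (Prop_irrelevance f0 g0).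
Qed.

(** * The action of words on a module *)

Section WordAction.
Variables (E : Type) (A : pzRingType) (sigma : E -> {rmorphism A -> A}).
Variable M : lmodType A.
Variable sigmaM : forall i, {linear ext_scal (sigma i) M -> M}.

Definition letter_act (i : E) (m : M) : M := sigmaM i (tens (sigma i) 1 m).

Definition word_act (u : seq E) (m : M) : M := foldr letter_act m u.

Lemma word_act_cat u v m : word_act (u ++ v) m = word_act u (word_act v m).
Proof. exact: foldr_cat. Qed.

Lemma sigma_tens i b m : sigmaM i (tens (sigma i) b m) = b *: letter_act i m.
Proof. by rewrite /letter_act -linearZ /= tensZ mulr1. Qed.

Lemma letter_actD i : {morph letter_act i : m n / m + n}.
Proof. by move=> m n; rewrite /letter_act tensDr linearD. Qed.

Lemma letter_actZ i a m : letter_act i (a *: m) = sigma i a *: letter_act i m.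
Proof. by rewrite -sigma_tens /letter_act -tens_bal mul1r. Qed.

Lemma word_actD u : {morph word_act u : m n / m + n}.
Proof. by move=> m n; elim: u => //= i u ->; rewrite letter_actD. Qed.

Lemma word_actZ u a m :
  word_act u (a *: m) = word_endo sigma u a *: word_act u m.
Proof. by elim: u => //= i u ->; rewrite letter_actZ. Qed.

Lemma word_act_zmod_morphism u : zmod_morphism (word_act u).
Proof.
move=> m n; rewrite word_actD; congr (_ + _).
by rewrite -scaleN1r word_actZ rmorphN1 scaleN1r.
Qed.

(** The generalisation over the prefix, of which [tau] is the endomorphism and
    [h] the composite, is what makes the induction on the suffix [u] work. *)
Lemma word_comp_from_tens u (tau : {rmorphism A -> A})
    (h : {linear ext_scal tau M -> M}) b m :
  word_comp_from sigmaM h u (tens (tau \o word_endo sigma u) b m)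
  = h (tens tau b (word_act u m)).
Proof.
elim: u tau h => [|i u IHu] tau h //=.
have -> := IHu (tau \o sigma i : {rmorphism A -> A})
  (h \o (ext_map tau (sigmaM i) \o ext_assoc tau (sigma i) M)).
by rewrite /= ext_assoc_tens ext_map_tens.
Qed.

Lemma word_comp_tens u b m :
  word_comp sigmaM u (tens (word_endo sigma u) b m) = b *: word_act u m.
Proof.
case: u => [|i u] /=; first exact: ext_unit_tens.
have -> := word_comp_from_tens u (sigmaM i) b m.
exact: sigma_tens.
Qed.

End WordAction.

(** Pure tensors [1 (x) m] determine a linear map on [sigma^* M]. *)
Lemma ext_scal_linear_eq (A : pzRingType) (sigma : A -> A) (M N : lmodType A)
    (f g : {linear ext_scal sigma M -> N}) :
  (forall m, f (tens sigma 1 m) = g (tens sigma 1 m)) -> f =1 g.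
Proof.
move=> fg x; elim/tens_ind: x => [|x y hx hy|b m]; first by rewrite !linear0.
- by rewrite !linearB hx hy.
- by rewrite -[b]mulr1 -tensZ !linearZ /= fg.
Qed.

Section Isomorphism.
Variables (E : Type) (Gam : set (seq E * seq E)) (A : twisted_ring Gam).
Local Notation G := (presented Gam).
Local Notation AG := (twisted_monoid_ring A).

(** * From twisted modules to modules over the presented monoid *)

Section ToMonoid.
Variable M : twisted_module A.

(** The relation [u . m = v . m] is a congruence on words, so the conditions
    in [Gam], read on the tensors [1 (x) m], are enough. *)
Lemma word_act_cong u v : word_cong Gam u v ->
  word_act (twm_sigma M) u =1 word_act (twm_sigma M) v.
Proof.
elim=> [{}u {}v uv|{}u|{}u {}v _ h|{}u {}v w _ h1 _ h2|{}u {}v u' v' _ h1 _ h2] m.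
- have := twm_cond (t := M) uv (tens _ 1 m).
  by rewrite /= ext_cast_tens !word_comp_tens !scale1r.
- by [].
- by rewrite h.
- by rewrite h1 h2.
- by rewrite !word_act_cat h2 h1.
Qed.

Definition class_act (g : G) : M -> M := word_act (twm_sigma M) (repr g).

HB.instance Definition _ g := GRing.isZmodMorphism.Build M M (class_act g)
  (word_act_zmod_morphism (twm_sigma M) (repr g)).

Lemma class_act_class u :
  class_act (word_class Gam u) =1 word_act (twm_sigma M) u.
Proof. exact/word_act_cong/word_cong_repr. Qed.

Lemma class_act1 : class_act 1%g =1 id.
Proof. exact: (class_act_class [::]). Qed.

Lemma class_actM g h : class_act (g * h)%g =1 class_act g \o class_act h.
Proof.
move=> m; rewrite (_ : (g * h)%g = word_class Gam (repr g ++ repr h)) //.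
by rewrite class_act_class word_act_cat.
Qed.

Definition to_monoid_obj : monoid_module AG :=
  @MonoidModule G AG M (fun g => class_act g : {additive M -> M})
    class_act1 class_actM (fun g => word_actZ (twm_sigma M) (repr g)).

End ToMonoid.

Section ToMonoidHom.
Variables (M N : twisted_module A) (f : twisted_hom M N).

(** On the tensors [1 (x) m] the compatibility of [f] with [sigma_{M,i}] is
    equivariance for the letter [i]; letters generate all words. *)
Lemma twisted_hom_word_act u m :
  word_act (twm_sigma N) u (f m) = f (word_act (twm_sigma M) u m).
Proof.
elim: u => //= i u ->; move: (word_act _ u m) => n; rewrite /letter_act.
by have /= <- := twh_comm f (tens (tw_sigma A i) 1 n); rewrite ext_map_tens.
Qed.

Definition to_monoid_hom : monoid_hom (to_monoid_obj M) (to_monoid_obj N) :=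
  @MonoidHom G AG (to_monoid_obj M) (to_monoid_obj N) f
    (fun g => twisted_hom_word_act (repr g)).

End ToMonoidHom.

Definition to_monoid : functor (twisted_modules A) (monoid_modules AG).
Proof.
refine (@Functor (twisted_modules A) (monoid_modules AG) to_monoid_obj
  to_monoid_hom _ _) => *; exact: monoid_hom_eq.
Defined.

(** * From modules over the presented monoid to twisted modules *)

Section ToTwisted.
Variable M : monoid_module AG.

Lemma mm_act_letter_linear i :
  linear_for (tw_sigma A i \; *:%R) (mm_act M (word_class Gam [:: i])).
Proof. by move=> a m n; rewrite raddfD /= mm_actZ /= tw_act_letter. Qed.

Definition to_twisted_sigma i : {linear ext_scal (tw_sigma A i) M -> M} :=
  ext_lift (mm_act_letter_linear i).

(** The action rebuilt from letters is the original one, so the conditions in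
    [Gam] hold because they are equalities between classes. *)
Lemma to_twisted_word_act u :
  word_act to_twisted_sigma u =1 mm_act M (word_class Gam u).
Proof.
move=> m; elim: u => [|i u /= ->]; first by rewrite (mm_act1 (m := M)).
rewrite /letter_act ext_lift_tens scale1r.
have /= <- := mm_actM (m := M) (word_class Gam [:: i]) (word_class Gam u) m.
by congr (mm_act M _ m); exact: pres_mulE.
Qed.

Lemma to_twisted_cond u v (uv : Gam (u, v)) :
  word_comp to_twisted_sigma u
  =1 word_comp to_twisted_sigma v \o ext_cast (tw_cond (t := A) uv) M.
Proof.
apply: ext_scal_linear_eq => m.
rewrite /= ext_cast_tens !word_comp_tens !to_twisted_word_act.
by congr (_ *: mm_act M _ m); apply/word_classP/WordCongCond.
Qed.

Definition to_twisted_obj : twisted_module A := TwistedModule to_twisted_cond.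

End ToTwisted.

Section ToTwistedHom.
Variables (M N : monoid_module AG) (f : monoid_hom M N).

Lemma to_twisted_comm i :
  to_twisted_sigma N i \o ext_map (tw_sigma A i) f =1 f \o to_twisted_sigma M i.
Proof.
apply: ext_scal_linear_eq => m.
rewrite /= ext_map_tens !ext_lift_tens !scale1r.
exact: (mh_comm f (word_class Gam [:: i]) m).
Qed.

Definition to_twisted_hom : twisted_hom (to_twisted_obj M) (to_twisted_obj N) :=
  @TwistedHom E Gam A (to_twisted_obj M) (to_twisted_obj N) f to_twisted_comm.

End ToTwistedHom.

Definition to_twisted : functor (monoid_modules AG) (twisted_modules A).
Proof.
refine (@Functor (monoid_modules AG) (twisted_modules A) to_twisted_obj
  to_twisted_hom _ _) => *; exact: twisted_hom_eq.
Defined.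

(** * The two round trips *)

(** The equality is bundled with the description of the morphism that it
    induces: for the equality found by replacing [s'] with [s], that morphism is
    the identity by computation. *)
Lemma twisted_eq_hom (m : lmodType A)
    (s s' : forall i, {linear ext_scal (tw_sigma A i) m -> m}) c c' :
  (forall i, s i =1 s' i) ->
  exists e : @TwistedModule E Gam A m s c = @TwistedModule E Gam A m s' c',
    twh_fun (@eq_hom (twisted_modules A) _ _ e) =1 id.
Proof.
move=> ss'; have {ss'}ss' : s = s'.
  by apply: functional_extensionality_dep => i; apply: linear_eq; exact: ss'.
by subst s'; rewrite (Prop_irrelevance c' c); exists erefl.
Qed.

Lemma monoid_eq_hom (m : lmodType AG) (a a' : G -> {additive m -> m})
    c1 c1' cM cM' cZ cZ' :
  (forall g, a g =1 a' g) ->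
  exists e : @MonoidModule G AG m a c1 cM cZ = @MonoidModule G AG m a' c1' cM' cZ',
    mh_fun (@eq_hom (monoid_modules AG) _ _ e) =1 id.
Proof.
move=> aa'; have {aa'}aa' : a = a'.
  by apply: funext => g; apply: additive_eq; exact: aa'.
subst a'; rewrite (Prop_irrelevance c1' c1) (Prop_irrelevance cM' cM).
by rewrite (Prop_irrelevance cZ' cZ); exists erefl.
Qed.

Lemma to_monoidK : functor_comp to_twisted to_monoid = functor_id (twisted_modules A).
Proof.
have e (M : twisted_modules A) : exists e : to_twisted (to_monoid M) = M,
    forall m, twh_fun (eq_hom e) m = m.
  case: M => m s c; apply: twisted_eq_hom => i.
  apply: ext_scal_linear_eq => x; rewrite ext_lift_tens scale1r.
  exact: class_act_class.
apply: (@functor_eq_id _ (functor_comp to_twisted to_monoid)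
  (fun M => projT1 (cid (e M)))) => M N f.
apply: twisted_hom_eq => x.
have /= eN := projT2 (cid (e N)); have /= eM := projT2 (cid (e M)).
by rewrite /= eN eM.
Qed.

Lemma to_twistedK : functor_comp to_monoid to_twisted = functor_id (monoid_modules AG).
Proof.
have e (M : monoid_modules AG) : exists e : to_monoid (to_twisted M) = M,
    forall m, mh_fun (eq_hom e) m = m.
  case: M => m a c1 cM cZ; apply: monoid_eq_hom => g x.
  by rewrite [RHS]/= [in RHS](word_class_repr g); exact: to_twisted_word_act.
apply: (@functor_eq_id _ (functor_comp to_monoid to_twisted)
  (fun M => projT1 (cid (e M)))) => M N f.
apply: monoid_hom_eq => x.
have /= eN := projT2 (cid (e N)); have /= eM := projT2 (cid (e M)).
by rewrite /= eN eM.
Qed.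

Lemma twisted_modules_isomorphic :
  cat_isomorphic (twisted_modules A) (monoid_modules AG).
Proof. by exists to_monoid, to_twisted; split; [exact: to_monoidK|exact: to_twistedK]. Qed.

End Isomorphism.

Theorem proposition2p11 (E : Type) (Gam : set (seq E * seq E))
    (A : twisted_ring Gam) :
  cat_equivalent (twisted_modules A)
    (monoid_modules (twisted_monoid_ring A)) /\
  cat_isomorphic (twisted_modules A)
    (monoid_modules (twisted_monoid_ring A)).
Proof.
have iso := twisted_modules_isomorphic A.
by split; first exact: cat_isomorphic_equivalent.
Qed.
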